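(* Let $r$ be a positive integer, and consider a positive integer $m_P$ for every collectable $r$-pattern $P$. Let $\mathcal{H}$ be an ordered $r$-uniform hypergraph matching, and assume that for every collectable $r$-pattern $P$, every $P$-clique contained in $\mathcal{H}$ has size at most $m_P$. Then \[|\mathcal{H}|\le 2^{r-1} \sum_{\lambda^{(1)} \succ \lambda^{(2)} \succ \dots \succ \lambda^{(r)}}\ \prod_{P\in \mathcal{P}(\lambda^{(1)})\cup\dots\cup \mathcal{P}(\lambda^{(r)})} m_{P},\] where the sum is over all sequences $\lambda^{(1)} \succ \lambda^{(2)} \succ \dots \succ \lambda^{(r)}$ of ordered partitions of $r$ (for $s=1,\dots,r$, $\lambda^{(s)}$ then automatically has $s$ parts).
   Context: An ordered $r$-uniform hypergraph matching is a finite collection of pairwise disjoint sets (edges), each of size $r$, with a total ordering on the union of the edges (the vertex set). An $r$-pattern is a string in $\{\mathrm{A},\mathrm{B}\}^{2r}$ starting with $\mathrm{A}$ and containing exactly $r$ letters $\mathrm{A}$ and $r$ letters $\mathrm{B}$; two distinct edges $e,f$ form the $r$-pattern obtained by listing the vertices of $e\cup f$ in order and writing $\mathrm{A}$ for vertices of one edge and $\mathrm{B}$ for the other, with the labels chosen so the string starts with $\mathrm{A}$. A $P$-clique is a set of edges any two of which form the pattern $P$. A block partition of an $r$-pattern is a division of the string into consecutive blocks of even length, each of the form $\mathrm{A}^k\mathrm{B}^k$ or $\mathrm{B}^k\mathrm{A}^k$; such a partition is unique if it exists, and a pattern is collectable if it has one. An ordered partition of $r$ is a sequence $\lambda=(\lambda_1,\dots,\lambda_s)$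 of positive integers with sum $r$ ($s$ is its number of parts). We write $\lambda\succ\lambda'$ if $\lambda'$ is obtained from $\lambda$ by splitting some summands into smaller consecutive sub-summands (without reordering or recombining), i.e. the interval partition of $\{1,\dots,r\}$ given by $\lambda'$ refines that of $\lambda$. For an ordered partition $\lambda=(\lambda_1,\dots,\lambda_s)$, $\mathcal{P}(\lambda)$ is the set of collectable $r$-patterns whose block partition has $s$ blocks of lengths $2\lambda_1,\dots,2\lambda_s$ in this order. *)

(* Defs.v *)
From HB Require Import structures.
From mathcomp Require Import all_boot all_order.

Set Implicit Arguments.
Unset Strict Implicit.
Unset Printing Implicit Defensive.

Import Order.TTheory.

(* The vertices are the elements of [cover H], ordered as in [T]; some elements
   of [T] may be uncovered. *)
Definition ordered_matching (r : nat) d (T : finOrderType d)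
    (H : {set {set T}}) : bool :=
  trivIset H && [forall e in H, #|e| == r].

Notation letter := bool.
Definition letA : letter := true.
Definition letB : letter := false.

Definition is_pattern (r : nat) (P : (r.*2).-tuple letter) : bool :=
  [&& ohead P == Some letA, count_mem letA P == r & count_mem letB P == r].

Definition edge_word d (T : finOrderType d) (e f : {set T}) : seq letter :=
  [seq if v \in e then letA else letB | v <- sort <=%O (enum (e :|: f))].

(* [P] starts with A, so at most one of the two labellings can give [P]. *)
Definition forms_pattern (r : nat) (P : (r.*2).-tuple letter)
    d (T : finOrderType d) (e f : {set T}) : bool :=
  is_pattern P &&
  ((edge_word e f == P :> seq letter) || (edge_word f e == P :> seq letter)).

Definition is_clique (r : nat) (P : (r.*2).-tuple letter)
    d (T : finOrderType d) (K : {set {set T}}) : bool :=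
  [forall e in K, forall f in K, (e != f) ==> forms_pattern P e f].

Definition is_block (w : seq letter) : bool :=
  let k := (size w)./2 in
  (0 < k) && ((w == nseq k letA ++ nseq k letB)
              || (w == nseq k letB ++ nseq k letA)).

Definition is_block_partition (w : seq letter) (bs : seq (seq letter)) : bool :=
  (flatten bs == w) && all is_block bs.

Definition collectable (r : nat) (P : (r.*2).-tuple letter) : Prop :=
  is_pattern P /\ exists bs, is_block_partition P bs.

Definition is_ordpart (r : nat) (s : seq nat) : bool :=
  (0 \notin s) && (sumn s == r).

Record ordpart (r : nat) := OrdPart {
  parts :> seq nat;
  partsP : is_ordpart r parts
}.

HB.instance Definition _ r := [isSub for @parts r].
HB.instance Definition _ r := [Countable of ordpart r by <:].

(* [ordpart r] is finite: it embeds in the sequences of at most [r] integers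
   in [0, r]. *)
Section OrdPartFinite.
Variable r : nat.

Definition ordpart_code (l : ordpart r) : r.-bseq 'I_r.+1 :=
  insub_bseq r [seq inord n | n <- l].

Definition ordpart_decode (c : r.-bseq 'I_r.+1) : option (ordpart r) :=
  insub [seq val i | i <- c].

Lemma leq_size_sumn (s : seq nat) : 0 \notin s -> size s <= sumn s.
Proof.
elim: s => //= n s IHs; rewrite inE negb_or eq_sym -lt0n => /andP[n_gt0 /IHs].
by rewrite -add1n; apply: leq_add.
Qed.

Lemma leq_mem_sumn (s : seq nat) n : n \in s -> n <= sumn s.
Proof.
elim: s => //= m s IHs; rewrite inE => /predU1P[-> | /IHs le_n].
  exact: leq_addr.
exact: leq_trans le_n (leq_addl _ _).
Qed.

Lemma ordpart_codeK : pcancel ordpart_code ordpart_decode.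
Proof.
move=> l; rewrite /ordpart_code /ordpart_decode.
have /andP[l_pos /eqP l_sum] := partsP l.
rewrite /insub_bseq insubdK; last first.
  by rewrite unfold_in size_map -[X in _ <= X]l_sum leq_size_sumn.
rewrite -map_comp map_id_in ?valK // => n n_l /=.
by rewrite inordK // ltnS -l_sum leq_mem_sumn.
Qed.

End OrdPartFinite.

HB.instance Definition _ r : isFinite (ordpart r) :=
  PCanIsFinite (@ordpart_codeK r).

(* Strict refinement: [nu] lists the numbers of consecutive sub-summands of [l']
   into which the successive summands of [l] are split. *)
Definition splits_to (l l' : seq nat) : bool :=
  (l != l') &&
  [exists nu : ordpart (size l'), map sumn (reshape nu l') == l].

Definition ordpart_succ (r : nat) : rel (ordpart r) :=
  fun l l' => splits_to l l'.

Lemma splits_toP r (l l' : ordpart r) :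
  reflect (l != l' /\ exists mu : seq (seq nat),
             flatten mu = l' /\ map sumn mu = l)
          (ordpart_succ l l').
Proof.
apply: (iffP andP) => [[ne /existsP[nu /eqP nuE]] | [ne [mu [muE lE]]]].
  split=> //; exists (reshape nu l'); split=> //; apply: reshapeKr.
  by have /andP[_ /eqP->] := partsP nu.
split=> //.
have nuP : is_ordpart (size l') (shape mu).
  rewrite /is_ordpart -muE size_flatten eqxx andbT.
  have /andP[l_pos _] := partsP l; move: l_pos; rewrite -lE.
  by apply: contraNN => /mapP[[|//] s_mu _]; apply/mapP; exists [::].
by apply/existsP; exists (OrdPart nuP) => /=; rewrite -muE flattenK lE.
Qed.

(* [reshape] divides [P] into consecutive blocks of the prescribed lengths. *)
Definition patterns_of (r : nat) (l : ordpart r) :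
    {set (r.*2).-tuple letter} :=
  [set P | is_pattern P &&
           is_block_partition P (reshape [seq n.*2 | n <- l] P)].

Lemma patterns_ofP r (l : ordpart r) (P : (r.*2).-tuple letter) :
  reflect (collectable P /\ exists bs, is_block_partition P bs
             /\ shape bs = [seq n.*2 | n <- l])
          (P \in patterns_of l).
Proof.
rewrite inE; apply: (iffP andP) => [[Ppat Pbs] | [[Ppat _] [bs [Pbs bsE]]]].
  split; first by split=> //; exists (reshape [seq n.*2 | n <- l] P).
  exists (reshape [seq n.*2 | n <- l] P); split=> //; apply: reshapeKl.
  have /andP[_ /eqP lr] := partsP l; rewrite size_tuple -[X in _ <= X.*2]lr.
  by elim: (parts l) => [|n s IHs] /=; last by rewrite doubleD leq_add2l.
split=> //; suff -> : reshape [seq n.*2 | n <- l] P = bs by [].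
by have /andP[/eqP <- _] := Pbs; rewrite -bsE flattenK.
Qed.

(* Main.v *)
Require Import Defs.
From mathcomp Require Import all_boot all_order zify.
Set Implicit Arguments.
Unset Strict Implicit.
Unset Printing Implicit Defensive.
Import Order.TTheory.

(** A composition [l] of [r] cuts the sorted vertices of an edge into parts.
    Keep a family [F] of edges such that, at each cut [c] of [l], the first [c]
    vertices of any edge precede the last [r - c] vertices of any other.  If the
    parts of two edges of [F] are pairwise comparable, the edges form a pattern
    of [patterns_of l]; each such pattern is a strict partial order on [F], whose
    chains are cliques.  Mirsky's argument applied to each of these orders loses
    the factor [\prod_(P in patterns_of l) m P] and leaves a family in which any
    two edges overlap in some part: the first vertex of that part of one edge
    then separates the vertices of the other at a new cut [c].  Averaging over
    ordered pairs gives one edge [e] whose part-starting points separate, each at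
    its new cut, subfamilies of total size at least half of the family.  Each
    subfamily admits one more cut, so iterating from [[:: r]] costs [r - 1]
    factors of 2 and produces the sum over refinement chains. *)

(** * Compositions and their cuts *)

(* The cuts of [l], together with the total [sumn l]. *)
Fixpoint psums (l : seq nat) : seq nat :=
  if l is x :: l' then x :: [seq x + c | c <- psums l'] else [::].

(* The first index of the part of [l] that contains the index [c]. *)
Fixpoint part_start (l : seq nat) (c : nat) : nat :=
  if l is x :: l' then if c < x then 0 else x + part_start l' (c - x) else 0.

(** Intended for new cuts only: at an existing cut before the total, a part 0 would be inserted. *)
Fixpoint cut_at (c : nat) (l : seq nat) : seq nat :=
  if l is x :: l' then
    if c < x then [:: c, x - c & l'] else x :: cut_at (c - x) l'
  else [::].

Definition new_cut (l : seq nat) (c : nat) : bool :=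
  [&& 0 < c, c < sumn l & c \notin psums l].

Lemma new_cut_cons x l c : new_cut (x :: l) c ->
  (0 < c < x) \/ (x < c /\ new_cut l (c - x)).
Proof.
case/and3P => c0 cs; rewrite inE negb_or => /andP[cx nc].
have [cltx|] := ltnP c x; first by left; rewrite c0.
rewrite leq_eqVlt eq_sym (negPf cx) /= => xc; right; split=> //.
rewrite /new_cut subn_gt0 xc /= in cs *.
apply/andP; split; first by lia.
by apply: contra nc => h; apply/mapP; exists (c - x) => //; lia.
Qed.

Lemma new_cut_consr x l c : 0 < x -> new_cut l c -> new_cut (x :: l) (x + c).
Proof.
move=> x0 /and3P[c0 cs nc]; rewrite /new_cut /= addn_gt0 x0 ltn_add2l cs /=.
rewrite inE negb_or mem_map; last exact: addnI.
by rewrite nc andbT; lia.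
Qed.

Lemma part_start_leq l c : part_start l c <= c.
Proof.
elim: l c => //= x l IH c; case: ltnP => // xc.
by have := IH (c - x); lia.
Qed.

Lemma size_cut_at l c : new_cut l c -> size (cut_at c l) = (size l).+1.
Proof.
elim: l c => [|x l IH] c; first by rewrite /new_cut /= andbF.
case/new_cut_cons => [/andP[c0 cx]|[xc h]] /=; first by rewrite cx.
by rewrite ltnNge ltnW //= IH.
Qed.

Lemma is_ordpart_cut_at r l c :
  is_ordpart r l -> new_cut l c -> is_ordpart r (cut_at c l).
Proof.
elim: l r c => [|x l IH] r c; first by rewrite /new_cut /= andbF.
rewrite /is_ordpart inE negb_or => /andP[/andP[x0 n0] /eqP /= sr].
case/new_cut_cons => [/andP[c0 cx]|[xc h]] /=.
  rewrite cx /= !inE !negb_or n0 andbT; lia.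
rewrite ltnNge ltnW //= inE negb_or x0 /=.
have /(IH _ _)/(_ h)/andP[-> /eqP ->]: is_ordpart (sumn l) l by rewrite /is_ordpart n0 eqxx.
by apply/eqP.
Qed.

Lemma psums_cut_at l c : new_cut l c -> psums (cut_at c l) =i c :: psums l.
Proof.
elim: l c => [|x l IH] c; first by rewrite /new_cut /= andbF.
case/new_cut_cons => [/andP[c0 cx]|[xc h]] y /=.
  rewrite cx /= !inE -!map_comp; congr (_ || (_ || _)).
    by congr (_ == _); lia.
  by congr (_ \in _); apply: eq_map => z /=; lia.
rewrite ltnNge ltnW //= !inE orbCA; congr (_ || _).
have -> : (y == c) = (y \in [seq x + z | z <- [:: c - x]]).
  by rewrite inE; congr (_ == _); lia.
rewrite -mem_cat -map_cat; apply: eq_mem_map => z.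
by rewrite IH.
Qed.

Lemma cut_at_refines l c : new_cut l c ->
  exists mu : seq (seq nat), flatten mu = cut_at c l /\ map sumn mu = l.
Proof.
elim: l c => [|x l IH] c; first by rewrite /new_cut /= andbF.
case/new_cut_cons => [/andP[c0 cx]|[xc h]] /=.
  exists ([:: c; x - c] :: [seq [:: y] | y <- l]); rewrite cx /=; split.
    by rewrite flatten_map1 map_id.
  rewrite -map_comp; congr (_ :: _); first by lia.
  by rewrite -[RHS]map_id; apply: eq_map => z /=; lia.
have [mu [m1 m2]] := IH _ h.
exists ([:: x] :: mu); rewrite ltnNge ltnW //= m1 m2; split=> //.
by congr (_ :: _); lia.
Qed.

(** The new cut is recovered as the only member of [psums (cut_at c l)] outside [psums l]. Distinct
    cuts thus give distinct terms of the sum over chains. *)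
Lemma cut_at_inj l : {in new_cut l &, injective (cut_at^~ l)}.
Proof.
move=> c c' hc hc' /= e.
have := psums_cut_at hc c; rewrite e psums_cut_at // !inE eqxx /=.
by case/and3P: (hc) => _ _ /negPf ->; rewrite orbF => /eqP.
Qed.

(** With fewer than [r] parts, some part has size at least 2; cut just after its first element. This
    serves an edge paired with itself: its own vertex of index [c.-1] separates it at [c]. *)
Lemma exists_new_cut r l : is_ordpart r l -> size l < r ->
  exists2 c, new_cut l c & part_start l c = c.-1.
Proof.
elim: l r => [|x l IH] r; first by move=> /andP[_ /eqP <-].
rewrite /is_ordpart inE negb_or (eq_sym 0) -lt0n => /andP[/andP[x0 n0] /eqP /= sr] lr.
have [x1|x1] := ltnP 1 x.
  exists 1; last by rewrite /= x1.
  apply/and3P; split=> //=; first by lia.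
  by rewrite inE negb_or; apply/andP; split; [lia | apply/negP => /mapP[z _]; lia].
have [||c h1 h2] := IH (sumn l); first by rewrite /is_ordpart n0 eqxx.
  by lia.
exists (x + c); first exact: new_cut_consr.
rewrite /= ltnNge leq_addr /= addKn h2; case/andP: h1; lia.
Qed.

(** One more cut would give more than [r] positive parts of sum [r]. *)
Lemma all1_ordpart r l : is_ordpart r l -> r <= size l ->
  forall c, new_cut l c = false.
Proof.
move=> hl rl c; apply/negP => h.
have := size_cut_at h; have /andP[n0 /eqP sr] := is_ordpart_cut_at hl h.
by have := leq_size_sumn n0; lia.
Qed.

(** * Block words *)

(** The sign of a block is its leading letter, so block partitions with half-lengths [l] are encoded
    by sign lists of the same length. *)
Fixpoint block_word (l : seq nat) (s : seq bool) : seq bool :=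
  match l, s with
  | x :: l', b :: s' => nseq x b ++ nseq x (~~ b) ++ block_word l' s'
  | _, _ => [::]
  end.

Fixpoint signs (l : seq nat) (w : seq bool) : seq bool :=
  if l is x :: l' then head false w :: signs l' (drop x.*2 w) else [::].

Lemma size_block_word l s : size s = size l -> size (block_word l s) = (sumn l).*2.
Proof.
elim: l s => [|x l IH] [|b s] //= [ss].
by rewrite !size_cat !size_nseq IH // addnA addnn doubleD.
Qed.

Lemma drop_block x b (w : seq bool) :
  drop x.*2 (nseq x b ++ nseq x (~~ b) ++ w) = w.
Proof. by rewrite catA drop_size_cat // size_cat !size_nseq addnn. Qed.

Lemma take_block x b (w : seq bool) :
  take x.*2 (nseq x b ++ nseq x (~~ b) ++ w) = nseq x b ++ nseq x (~~ b).
Proof. by rewrite catA take_size_cat // size_cat !size_nseq addnn. Qed.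

Lemma signs_block_word l s :
  0 \notin l -> size s = size l -> signs l (block_word l s) = s.
Proof.
elim: l s => [|x l IH] [|b s] //=.
rewrite inE negb_or (eq_sym 0) -lt0n => /andP[x0 n0] [ss].
by rewrite drop_block IH //; case: x x0.
Qed.

Lemma block_word_inj l l' s s' : 0 \notin l -> 0 \notin l' ->
  size s = size l -> size s' = size l' -> block_word l s = block_word l' s' -> l = l'.
Proof.
have find_block x b (w : seq bool) : 0 < x ->
  find (predC1 b) (nseq x b ++ nseq x (~~ b) ++ w) = x.
  move=> x0; rewrite find_cat has_nseq /= eqxx andbF size_nseq find_cat has_nseq x0 /=.
  by case: x x0 b => // x _ [] /=; rewrite addn0.
elim: l l' s s' => [|x l IH] [|x' l'] [|b s] [|b' s'] //=.
- by rewrite inE negb_or; case: x'.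
- by rewrite inE negb_or; case: x.
rewrite !inE !negb_or !(eq_sym 0) -!lt0n => /andP[x0 n0] /andP[x0' n0'] [ss] [ss'] e.
have eb : b = b' by case: x x' x0 x0' e => [|x] [|x'] //= _ _ [].
have ex : x = x' by rewrite -(find_block _ b (block_word l s) x0) e eb find_block.
subst x' b'; congr (_ :: _); apply: (IH _ s s') => //.
by have := congr1 (drop x.*2) e; rewrite !drop_block.
Qed.

Lemma is_block_nseq x b : 0 < x -> is_block (nseq x b ++ nseq x (~~ b)).
Proof.
move=> x0; rewrite /is_block size_cat !size_nseq addnn doubleK x0 /=.
by case: b; rewrite eqxx ?orbT.
Qed.

Lemma block_partition_word l s : 0 \notin l -> size s = size l ->
  is_block_partition (block_word l s) (reshape [seq n.*2 | n <- l] (block_word l s)).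
Proof.
rewrite /is_block_partition.
elim: l s => [|x l IH] [|b s] //=.
rewrite inE negb_or (eq_sym 0) -lt0n => /andP[x0 n0] [ss].
rewrite drop_block take_block is_block_nseq //=.
have /andP[/eqP -> ->] := IH s n0 ss.
by rewrite -catA eqxx.
Qed.

Lemma word_of_block_partition l w : 0 \notin l -> size w = (sumn l).*2 ->
  is_block_partition w (reshape [seq n.*2 | n <- l] w) ->
  exists2 s, size s = size l & w = block_word l s.
Proof.
rewrite /is_block_partition.
elim: l w => [|x l IH] w /=.
  by move=> _; case: w => // _ _; exists [::].
rewrite inE negb_or (eq_sym 0) -lt0n => /andP[x0 n0] sw /andP[/eqP e /andP[hb ha]].
have sd : size (drop x.*2 w) = (sumn l).*2 by rewrite size_drop sw doubleD addKn.
have st : size (take x.*2 w) = x.*2 by rewrite size_takel // sw doubleD leq_addr.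
have fe : flatten (reshape [seq n.*2 | n <- l] (drop x.*2 w)) = drop x.*2 w.
  move/eqP: e; rewrite -{3}(cat_take_drop x.*2 w) eqseq_cat // eqxx.
  by move/eqP.
have [|s ss es] := IH _ n0 sd; first by rewrite fe eqxx.
have [b eb] : exists b, take x.*2 w = nseq x b ++ nseq x (~~ b).
  move: hb; rewrite /is_block st doubleK => /andP[_ /orP[]/eqP->]; [by exists true | by exists false].
exists (b :: s); first by rewrite /= ss.
by rewrite /= catA -eb -es cat_take_drop.
Qed.

Lemma count_block_word l s b : size s = size l ->
  count_mem b (block_word l s) = sumn l.
Proof.
elim: l s => [|x l IH] [|a s] //= [ss].
rewrite !count_cat !count_nseq IH //=.
by case: a b {IH} => [] [] /=; lia.
Qed.

(** * Sorted words with interlaced or comparable parts *)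

Definition sep_at d (T : orderType d) (c : nat) (u v : seq T) : bool :=
  allrel <%O (take c u) (drop c v).

(** The total belongs to [psums l] but imposes nothing on sequences of length [sumn l], since
    dropping that many entries leaves none. *)
Definition separated d (T : orderType d) (l : seq nat) (u v : seq T) : bool :=
  all (fun c => sep_at c u v && sep_at c v u) (psums l).

Fixpoint parts_ordered d (T : orderType d) (l : seq nat) (s : seq bool) (u v : seq T) : bool :=
  match l, s with
  | x :: l', b :: s' =>
      allrel <%O (take x (if b then u else v)) (take x (if b then v else u))
      && parts_ordered l' s' (drop x u) (drop x v)
  | _, _ => true
  end.

Fixpoint merge_parts T (l : seq nat) (s : seq bool) (u v : seq T) : seq T :=
  match l, s with
  | x :: l', b :: s' =>
      take x (if b then u else v) ++ take x (if b then v else u)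
      ++ merge_parts l' s' (drop x u) (drop x v)
  | _, _ => [::]
  end.

(** The inequality is weak on the left so that an entry of [u] can pierce [u] itself, right after
    its own position. *)
Definition pierced d (T : orderType d) (c : nat) (p : T) (u : seq T) : bool :=
  all (<=%O^~ p) (take c u) && all (<%O p) (drop c u).

Lemma separated_cons d (T : orderType d) x l (u v : seq T) :
  separated (x :: l) u v ->
  [/\ sep_at x u v, sep_at x v u & separated l (drop x u) (drop x v)].
Proof.
rewrite {1}/separated /= => /andP[/andP[-> ->] h]; split=> //.
move: h; rewrite all_map; apply: sub_all => c /=.
have sub (u' v' : seq T) :
    sep_at (x + c) u' v' -> sep_at c (drop x u') (drop x v').
  rewrite /sep_at drop_drop (addnC c x) => /allrelP h; apply/allrelP => y z.
  by rewrite take_drop (addnC c x) => /mem_drop; apply: h.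
by case/andP => /sub -> /sub ->.
Qed.

Lemma sorted_sep_at d (T : orderType d) c (u : seq T) : sorted <%O u -> sep_at c u u.
Proof.
rewrite lt_sorted_pairwise -{1}(cat_take_drop c u) pairwise_cat.
by case/andP.
Qed.

Lemma pierced_sep_at d (T : orderType d) c p (u v : seq T) :
  pierced c p u -> pierced c p v -> sep_at c u v.
Proof.
case/andP=> /allP hu _ /andP[_ /allP hv]; apply/allrelP => y z /hu yp /hv pz.
exact: le_lt_trans yp pz.
Qed.

Lemma perm_merge_parts (T : eqType) l s (u v : seq T) : size s = size l ->
  size u = sumn l -> size v = sumn l -> perm_eq (merge_parts l s u v) (u ++ v).
Proof.
elim: l s u v => [|x l IH] [|b s] u v //=.
  by move=> _ /size0nil -> /size0nil ->.
move=> [ss] su sv.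
have sdu : size (drop x u) = sumn l by rewrite size_drop su addKn.
have sdv : size (drop x v) = sumn l by rewrite size_drop sv addKn.
rewrite -[in X in perm_eq _ X](cat_take_drop x u) -[in X in perm_eq _ X](cat_take_drop x v).
apply/permP => a; rewrite !count_cat (permP (IH s _ _ ss sdu sdv)) count_cat.
by case: b; lia.
Qed.

(** Separation at [x] puts both leading parts before everything later; the sign orders the two
    leading parts against each other. *)
Lemma sorted_merge_parts d (T : orderType d) l s (u v : seq T) : size s = size l ->
  size u = sumn l -> size v = sumn l -> sorted <%O u -> sorted <%O v ->
  separated l u v -> parts_ordered l s u v -> sorted <%O (merge_parts l s u v).
Proof.
elim: l s u v => [|x l IH] [|b s] u v // [ss] su sv ou ov.
case/separated_cons => huv hvu sl /= /andP[ho hr].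
have huu := sorted_sep_at x ou; have hvv := sorted_sep_at x ov.
have sdu : size (drop x u) = sumn l by rewrite size_drop su addKn.
have sdv : size (drop x v) = sumn l by rewrite size_drop sv addKn.
have /= om := IH s _ _ ss sdu sdv (drop_sorted _ ou) (drop_sorted _ ov) sl hr.
have hM := perm_mem (perm_merge_parts ss sdu sdv).
have hb (w : seq T) : sep_at x w u -> sep_at x w v ->
    allrel <%O (take x w) (merge_parts l s (drop x u) (drop x v)).
  move=> h1 h2; rewrite (eq_allrel_memr _ _ hM) allrel_catr.
  by apply/andP; split.
rewrite lt_sorted_pairwise !pairwise_cat -!lt_sorted_pairwise om andbT allrel_catr ho /=.
by case: b {ho}; rewrite !take_sorted // !hb.
Qed.

Lemma map_merge_parts T (a : pred T) l s (u v : seq T) : size s = size l ->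
  size u = sumn l -> size v = sumn l -> all a u -> all (predC a) v ->
  map a (merge_parts l s u v) = block_word l s.
Proof.
have map_const b (w : seq T) : all (fun y => a y == b) w -> map a w = nseq (size w) b.
  by elim: w => //= y w IH /andP[/eqP -> /IH ->].
elim: l s u v => [|x l IH] [|b s] u v // [ss] /= su sv au av.
have sdu : size (drop x u) = sumn l by rewrite size_drop su addKn.
have sdv : size (drop x v) = sumn l by rewrite size_drop sv addKn.
have stu : size (take x u) = x by rewrite size_takel // su leq_addr.
have stv : size (take x v) = x by rewrite size_takel // sv leq_addr.
move: (au) (av); rewrite -{1}(cat_take_drop x u) -{1}(cat_take_drop x v) !all_cat.
case/andP => atu adu /andP[atv adv].
have mu : map a (take x u) = nseq x true.
  by rewrite -stu -map_const //; [rewrite stu | apply: sub_all atu => y /= ->].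
have mv : map a (take x v) = nseq x false.
  by rewrite -stv -map_const //; [rewrite stv | apply: sub_all atv => y /= /negPf ->].
by rewrite !map_cat IH //; case: b; rewrite mu mv.
Qed.

(** Parts are nonempty, so each part of [v] supplies an entry lying between the corresponding parts
    of [u] and [w]. *)
Lemma parts_ordered_trans d (T : orderType d) l s (v u w : seq T) :
  0 \notin l -> size v = sumn l ->
  parts_ordered l s u v -> parts_ordered l s v w -> parts_ordered l s u w.
Proof.
elim: l s u v w => [|x l IH] [|b s] u v w //=.
rewrite inE negb_or (eq_sym 0) -lt0n => /andP[x0 n0] sv.
have sdv : size (drop x v) = sumn l by rewrite size_drop sv addKn.
have trans (w1 w2 : seq T) : allrel <%O (take x w1) (take x v) ->
    allrel <%O (take x v) (take x w2) -> allrel <%O (take x w1) (take x w2).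
  case: v sv {sdv} => [|y v] sv; first by move: sv => /=; lia.
  case: x x0 {sv} => //= x _ /allrelP h1 /allrelP h2; apply/allrelP => a b' ha hb.
  by apply: lt_trans (h1 _ _ ha (mem_head _ _)) (h2 _ _ (mem_head _ _) hb).
move=> /andP[h1 h2] /andP[h3 h4]; rewrite (IH _ _ _ _ n0 sdv h2 h4) andbT.
by case: b h1 h3 => h1 h3; apply: trans.
Qed.

Lemma parts_ordered_irr d (T : orderType d) l s (u : seq T) :
  0 < sumn l -> 0 \notin l -> size s = size l -> size u = sumn l ->
  parts_ordered l s u u = false.
Proof.
case: l s => [|x l] [|b s] //= _.
rewrite inE negb_or (eq_sym 0) -lt0n => /andP[x0 n0] _.
case: u => [|y u] /=; first by lia.
by case: x x0 => // x _ _; case: b; rewrite /= allrel_cons2 ltxx.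
Qed.

Lemma parts_orderedC d (T : orderType d) l s (u v : seq T) :
  parts_ordered l (map negb s) v u = parts_ordered l s u v.
Proof.
elim: l s u v => [|x l IH] [|b s] u v //=.
by rewrite IH; case: b.
Qed.

(** * Overlapping parts and piercing points *)

Lemma pierced_count d (T : orderType d) p (u : seq T) : sorted <%O u ->
  pierced (count (<=%O^~ p) u) p u.
Proof.
rewrite /pierced; elim: u => //= y u IH hp.
case: leP => [yp | py] /=.
  by rewrite yp; apply: IH; apply: path_sorted hp.
have hu : all (<%O p) u.
  move: hp; rewrite lt_path_sortedE => /andP[hy _].
  by apply: sub_all hy => z /= /(lt_trans py).
have -> : count (<=%O^~ p) u = 0.
  apply/eqP; rewrite -leqn0 leqNgt -has_count; apply/hasPn => z /(allP hu).
  by rewrite -ltNge.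
by rewrite /= py hu.
Qed.

Lemma nth_sorted_le d (T : orderType d) (x0 : T) (u : seq T) i j :
  sorted <%O u -> i <= j -> j < size u -> (nth x0 u i <= nth x0 u j)%O.
Proof.
by move=> ou ij ju; rewrite (lt_sorted_leq_nth x0 ou) ?inE //; apply: leq_ltn_trans ju.
Qed.

Lemma nth_sorted_lt d (T : orderType d) (x0 : T) (u : seq T) i j :
  sorted <%O u -> i < j -> j < size u -> (nth x0 u i < nth x0 u j)%O.
Proof.
by move=> ou ij ju; rewrite (lt_sorted_ltn_nth x0 ou) ?inE //; apply: ltn_trans ju.
Qed.

Lemma pierced_pred d (T : orderType d) (x0 : T) c (u : seq T) :
  sorted <%O u -> 0 < c <= size u -> pierced c (nth x0 u c.-1) u.
Proof.
move=> ou /andP[c0 cu]; apply/andP; split; apply/(all_nthP x0) => i.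
  by rewrite size_takel // => ic; rewrite nth_take // nth_sorted_le //; lia.
by rewrite size_drop => ic; rewrite nth_drop nth_sorted_lt //; lia.
Qed.

(** Let [c] count the entries of [u] up to the first entry of [v]. The first entry of [u] gives
    [0 < c]; an entry of [take x u] lying above some entry of [take x v] gives [c < x]. *)
Lemma pierced_overlap d (T : orderType d) (x0 : T) x (u v : seq T) :
  sorted <%O u -> sorted <%O v -> 0 < x <= size u -> x <= size v ->
  {in u & v, forall y z, y != z} ->
  ~~ allrel <%O (take x u) (take x v) -> (nth x0 u 0 <= nth x0 v 0)%O ->
  exists2 c, 0 < c < x & pierced c (nth x0 v 0) u.
Proof.
move=> ou ov /andP[x_gt0 xu] xv dis.
case/allPn => y yu /allPn[z zv]; rewrite -leNgt => zy le0.
have u_gt0 := leq_trans x_gt0 xu; have v_gt0 := leq_trans x_gt0 xv.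
have v0z : (nth x0 v 0 <= z)%O.
  have /(nthP x0)[i] := mem_take zv.
  by move=> iv <-; apply: nth_sorted_le.
have v0y : (nth x0 v 0 < y)%O.
  rewrite lt_neqAle (le_trans v0z zy) andbT eq_sym; apply: dis; first exact: mem_take yu.
  exact: mem_nth.
have hc := pierced_count (nth x0 v 0) ou.
exists (count (<=%O^~ (nth x0 v 0)) u) => //.
case/andP: hc => /allP h1 /allP h2; apply/andP; split.
  rewrite -has_count; apply/hasP; exists (nth x0 u 0) => //.
  exact: mem_nth.
rewrite ltnNge; apply/negP => xc.
have /h1 : y \in take (count (<=%O^~ (nth x0 v 0)) u) u.
  by move: yu; rewrite -(subnKC xc) takeD mem_cat => ->.
by rewrite leNgt v0y.
Qed.

(** At an overlapping part, the sequence whose part starts later pierces the other one. If no part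
    overlaps, the comparisons of the parts give the signs. *)
Lemma ordered_or_pierced d (T : orderType d) (x0 : T) l (u v : seq T) :
  0 \notin l -> size u = sumn l -> size v = sumn l ->
  sorted <%O u -> sorted <%O v -> separated l u v ->
  {in u & v, forall y z, y != z} ->
  (exists2 s, size s = size l & parts_ordered l s u v) \/
  (exists2 c, new_cut l c & pierced c (nth x0 v (part_start l c)) u
                         || pierced c (nth x0 u (part_start l c)) v).
Proof.
elim: l u v => [|x l IH] u v; first by left; exists [::].
rewrite inE negb_or (eq_sym 0) -lt0n => /andP[x_gt0 n0] /= su sv ou ov.
case/separated_cons => huv hvu sl dis.
have sdu : size (drop x u) = sumn l by rewrite size_drop su addKn.
have sdv : size (drop x v) = sumn l by rewrite size_drop sv addKn.
have cutx c : 0 < c < x -> new_cut (x :: l) c.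
  move=> /andP[c0 cx]; apply/and3P; split=> //=; first by lia.
  by rewrite inE negb_or; apply/andP; split; [lia | apply/negP => /mapP[z _]; lia].
(* A piercing point found in the tails also works for the full sequences: it lies in [drop x v'],
   hence above [take x u'] by separation at [x]. *)
have shift (u' v' : seq T) c : sep_at x u' v' -> size (drop x v') = sumn l ->
    new_cut l c -> pierced c (nth x0 (drop x v') (part_start l c)) (drop x u') ->
    pierced (x + c) (nth x0 v' (x + part_start l c)) u'.
  move=> /allrelP hs sd /and3P[_ cs _]; rewrite nth_drop => /andP[h1 h2].
  rewrite /pierced takeD all_cat h1 (addnC x c) -drop_drop h2 !andbT.
  apply/allP => y hy; apply/ltW/hs => //.
  rewrite -nth_drop; apply: mem_nth; rewrite sd.
  exact: leq_ltn_trans (part_start_leq _ _) cs.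
have [h1|h1] := boolP (allrel <%O (take x u) (take x v)); last first.
  have [h2|h2] := boolP (allrel <%O (take x v) (take x u)); last first.
    right; have [le0|/ltW le0] := leP (nth x0 u 0) (nth x0 v 0).
      have [||c hc pc] := pierced_overlap ou ov _ _ dis h1 le0; [by lia..|].
      by exists c; [apply: cutx | case/andP: hc => _ ->; rewrite pc].
    have dis' : {in v & u, forall y z, y != z}.
      by move=> y z yv zu; rewrite eq_sym; apply: dis.
    have [||c hc pc] := pierced_overlap ov ou _ _ dis' h2 le0; [by lia..|].
    by exists c; [apply: cutx | case/andP: hc => _ ->; rewrite pc orbT].
all: have dis2 : {in drop x u & drop x v, forall y z, y != z}
  by move=> y z /mem_drop yu /mem_drop zv; apply: dis.
all: case: (IH _ _ n0 sdu sdv (drop_sorted _ ou) (drop_sorted _ ov) sl dis2) =>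
  [[s ss hs]|[c hc pc]].
- by left; exists (false :: s); rewrite /= ?ss // h2.
- right; exists (x + c); first exact: new_cut_consr.
  by rewrite /= ltnNge leq_addr addKn; case/orP: pc => /shift -> //; rewrite orbT.
- by left; exists (true :: s); rewrite /= ?ss // h1.
right; exists (x + c); first exact: new_cut_consr.
by rewrite /= ltnNge leq_addr addKn; case/orP: pc => /shift -> //; rewrite orbT.
Qed.

(** * Counting *)

Lemma leq_sum_inj (I J : finType) (P : pred I) (Q : pred J) (h : I -> J) (G : J -> nat) :
  {in P &, injective h} -> (forall i, P i -> Q (h i)) ->
  \sum_(i | P i) G (h i) <= \sum_(j | Q j) G j.
Proof.
move=> hinj hPQ; rewrite -(big_imset G hinj) /=.
rewrite [X in _ <= X](bigID (mem [set h i | i in P])) /=.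
apply: leq_trans (leq_addr _ _); rewrite leq_eqVlt; apply/orP; left; apply/eqP.
apply: eq_bigl => j; apply/idP/andP => [hj|[]//]; split=> //.
by case/imsetP: hj => i Pi ->; apply: hPQ.
Qed.

(* Peeling off minimal elements: each layer shortens all chains by one. *)
Lemma large_antichain (I : finType) (R : rel I) (n : nat) (F : {set I}) :
  (forall s, all [in F] s -> sorted R s -> size s <= n) ->
  exists F' : {set I}, [/\ F' \subset F, {in F' &, forall x y, ~~ R x y} & #|F| <= n * #|F'|].
Proof.
elim: n F => [|n IH] F hF.
  exists F; split=> //.
    by move=> x y xF _; have := hF [:: x]; rewrite /= xF => /(_ isT isT).
  rewrite leqn0 cards_eq0; apply/set0Pn => -[x xF].
  by have := hF [:: x]; rewrite /= xF => /(_ isT isT).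
pose M := [set x in F | [forall y in F, ~~ R y x]].
have MF : M \subset F by apply/subsetP => x; rewrite inE => /andP[].
have anti : {in M &, forall x y, ~~ R x y}.
  move=> x y xM; rewrite inE => /andP[_ /forall_inP]; apply; exact: (subsetP MF).
have [|F' [sF' aF' cF']] := IH (F :\: M).
  (* A chain outside [M] extends below its first element, so it has at most [n] elements. *)
  move=> [//|x s] /= /andP[]; rewrite !inE => /andP[xM xF] sF hs.
  move: xM; rewrite xF /= negb_forall_in => /exists_inP[y yF]; rewrite negbK => Ryx.
  apply: (hF [:: y, x & s]); rewrite /= ?Ryx // yF xF.
  by apply: sub_all sF => z; rewrite !inE => /andP[].
have cF : #|F| = #|M| + #|F :\: M| by rewrite -(cardsID M F) (setIidPr MF).
(* Keep the larger of [M] and [F']: the bound [#|M| + n * #|F'|] is at most [n.+1] times its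
   size. *)
have [le|lt] := leqP #|M| #|F'|.
  exists F'; split=> //; first exact: subset_trans sF' (subsetDl _ _).
  by rewrite cF mulSn leq_add.
exists M; split=> //; rewrite cF mulSn leq_add2l.
by apply: leq_trans cF' _; rewrite leq_mul2l (ltnW lt) orbT.
Qed.

(** Treat the relations one after another: subfamilies inherit both the chain bounds and the
    antichain conditions already obtained, and the losses multiply. *)
Lemma large_common_antichain (I : finType) (J : eqType) (js : seq J) (R : J -> rel I)
    (n : J -> nat) (F : {set I}) :
  (forall j, j \in js -> forall s, all [in F] s -> sorted (R j) s -> size s <= n j) ->
  exists F' : {set I}, [/\ F' \subset F,
    forall j, j \in js -> {in F' &, forall x y, ~~ R j x y} &
    #|F| <= (\prod_(j <- js) n j) * #|F'|].
Proof.
elim: js F => [|j js IH] F hF; first by exists F; split; rewrite // big_nil mul1n.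
have [F1 [s1 a1 c1]] := large_antichain (hF j (mem_head _ _)).
have [|F2 [s2 a2 c2]] := IH F1.
  move=> i ij s sF; apply: hF; first by rewrite inE ij orbT.
  by apply: sub_all sF => x; apply: (subsetP s1).
exists F2; split; first exact: subset_trans s2 s1.
  move=> i; rewrite inE => /predU1P[-> x y xF yF|]; last exact: a2.
  by apply: a1; apply: (subsetP s2).
apply: leq_trans c1 _; rewrite big_cons -mulnA leq_mul2l c2 orbT //.
Qed.

(* Summing over all ordered pairs [(e, f)] counts each witness twice. *)
Lemma half_covered (I J : finType) (C : pred J) (A : I -> I -> J -> bool) (F : {set I}) :
  F != set0 ->
  {in F &, forall e f, exists2 c, C c & A e f c || A f e c} ->
  exists e, #|F| <= 2 * \sum_(c | C c) #|[set f in F | A e f c]|.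
Proof.
move=> F0 hA.
have [/exists_inP[e _ he]|] := boolP
    [exists e in F, #|F| <= 2 * \sum_(c | C c) #|[set f in F | A e f c]|].
  by exists e.
rewrite negb_exists_in => /forall_inP hlt; exfalso.
have cardA e : \sum_(c | C c) #|[set f in F | A e f c]| =
    \sum_(f in F) \sum_(c | C c) A e f c.
  rewrite exchange_big /=; apply: eq_bigr => c _.
  by rewrite -sum1dep_card big_mkcondr /=; apply: eq_bigr => f _; case: (A e f c).
(* Each ordered pair, diagonal ones included, contributes at least 1 to the symmetrised sum. *)
have lo : #|F| * #|F| <= 2 * \sum_(e in F) \sum_(f in F) \sum_(c | C c) A e f c.
  rewrite mul2n -addnn {2}exchange_big /= -big_split /=.
  rewrite -sum_nat_const; apply: leq_sum => e eF.
  rewrite -big_split /= -sum1_card; apply: leq_sum => f fF.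
  have [c Cc] := hA e f eF fF; rewrite -big_split /= (bigD1 c) //=.
  by case: (A e f c); case: (A f e c).
(* If every [e] in [F] fails the desired bound, each row leaves at least 1 to spare, hence [#|F|] in
   total. *)
have hi : 2 * \sum_(e in F) \sum_(f in F) \sum_(c | C c) A e f c + #|F| <= #|F| * #|F|.
  rewrite big_distrr /= -{1}sum1_card -big_split /= -sum_nat_const.
  by apply: leq_sum => e eF; rewrite -cardA addn1 ltnNge hlt.
by move: F0; rewrite -card_gt0; lia.
Qed.

(** * Families of edges of the matching *)

Section Families.
Variables (r : nat) (r_gt0 : 0 < r) (m : (r.*2).-tuple letter -> nat).
Variables (d : Order.disp_t) (T : finOrderType d) (H : {set {set T}}).
Hypothesis H_matching : ordered_matching r H.
Hypothesis H_cliques : forall P : (r.*2).-tuple letter, collectable P ->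
  forall K : {set {set T}}, K \subset H -> is_clique P K -> #|K| <= m P.

Definition vertices (e : {set T}) : seq T := sort <=%O (enum e).

Lemma sorted_vertices e : sorted <%O (vertices e).
Proof. by rewrite sort_lt_sorted enum_uniq. Qed.

Lemma mem_vertices e : vertices e =i e.
Proof. by move=> x; rewrite mem_sort mem_enum. Qed.

Lemma size_vertices e : e \in H -> size (vertices e) = r.
Proof.
move=> eH; have /andP[_ /forall_inP/(_ e eH)/eqP] := H_matching.
by rewrite size_sort -cardE.
Qed.

Lemma vertices_disjoint e f : e \in H -> f \in H -> e != f ->
  {in vertices e & vertices f, forall y z, y != z}.
Proof.
have /andP[/trivIsetP tH _] := H_matching.
move=> eH fH ef y z; rewrite !mem_vertices => ye zf.
have /pred0P/(_ y) /= := tH e f eH fH ef; rewrite ye /=.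
by apply: contraFN => /eqP ->.
Qed.

(** Merging the parts in the order given by the signs yields a sorted sequence with the elements of
    [e :|: f], hence the sorted union itself. *)
Lemma edge_word_merge l s e f : e \in H -> f \in H -> e != f ->
  is_ordpart r l -> size s = size l -> separated l (vertices e) (vertices f) ->
  parts_ordered l s (vertices e) (vertices f) -> edge_word e f = block_word l s.
Proof.
move=> eH fH ef /andP[_ /eqP sl] ss hsep ho.
have dis := vertices_disjoint eH fH ef.
have se : size (vertices e) = sumn l by rewrite size_vertices.
have sf : size (vertices f) = sumn l by rewrite size_vertices.
rewrite /edge_word -(map_merge_parts (a := [in e]) ss se sf); last 2 first.
- by apply/allP => y; rewrite mem_vertices.
- apply/allP => y yf /=; apply/negP => ye.
  by have := dis y y; rewrite mem_vertices ye yf eqxx => /(_ isT isT).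
have -> : sort <=%O (enum (e :|: f)) = merge_parts l s (vertices e) (vertices f).
  apply: lt_sorted_eq.
  - by rewrite sort_lt_sorted enum_uniq.
  - by apply: sorted_merge_parts => //; apply: sorted_vertices.
  move=> y; rewrite mem_sort mem_enum inE (perm_mem (perm_merge_parts ss se sf)).
  by rewrite mem_cat !mem_vertices.
by apply: eq_map => y; case: (y \in e).
Qed.

Lemma patterns_of_word (l : ordpart r) (P : (r.*2).-tuple letter) : P \in patterns_of l ->
  exists s, [/\ size s = size l, P = block_word l s :> seq _ & signs l P = s].
Proof.
have /andP[n0 /eqP sl] := partsP l.
rewrite inE => /andP[_ hP].
have [|s ss eP] := word_of_block_partition n0 _ hP; first by rewrite size_tuple sl.
by exists s; split=> //; rewrite eP signs_block_word.
Qed.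

Lemma patterns_of_collectable (l : ordpart r) P : P \in patterns_of l -> collectable P.
Proof. by case/patterns_ofP. Qed.

Lemma patterns_of_inj (l l' : ordpart r) P : P \in patterns_of l -> P \in patterns_of l' -> l = l'.
Proof.
have /andP[n0 _] := partsP l; have /andP[n0' _] := partsP l'.
move=> /patterns_of_word[s [ss e _]] /patterns_of_word[s' [ss' e' _]].
by apply/val_inj/(block_word_inj n0 n0' ss ss'); rewrite -e -e'.
Qed.

(** Patterns start with A, hence the condition on the first sign. Sign lists starting with B are
    handled by exchanging the two edges. *)
Lemma block_word_pattern (l : ordpart r) s : size s = size l -> head false s ->
  exists2 P, P \in patterns_of l & signs l P = s.
Proof.
have /andP[n0 /eqP sl] := partsP l => ss hs.
have sw : size (block_word l s) == r.*2 by rewrite size_block_word // sl.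
exists (Tuple sw); last exact: signs_block_word.
rewrite inE /= block_partition_word // andbT /is_pattern /= !count_block_word // sl eqxx andbT /=.
case: (parts l) s ss hs sl n0 {sw} => [|x l'] [|[] s] //=.
by case: x.
Qed.

Definition separated_family (l : seq nat) (F : {set {set T}}) : Prop :=
  {in F &, forall e f, separated l (vertices e) (vertices f)}.

(** By transitivity any two members of the chain are related, and related edges spell [P];
    irreflexivity excludes repetitions. So the chain lists a [P]-clique without duplicates. *)
Lemma chain_is_clique (l : ordpart r) P (F : {set {set T}}) s : P \in patterns_of l ->
  F \subset H -> separated_family l F -> all [in F] s ->
  sorted (fun e f => parts_ordered l (signs l P) (vertices e) (vertices f)) s -> size s <= m P.
Proof.
set R := (X in sorted X) => Pl FH Fsep sF.
have /andP[n0 /eqP sl] := partsP l.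
have [s' [ss eP es]] := patterns_of_word Pl.
have sv e : e \in F -> size (vertices e) = sumn l.
  by move=> /(subsetP FH) /size_vertices; rewrite sl.
have Rtr : {in F & &, transitive R}.
  by move=> f e g fF _ _; apply: parts_ordered_trans => //; apply: sv.
have Rirr : {in F, irreflexive R}.
  by move=> e eF; rewrite /R es parts_ordered_irr ?sl ?sv // sl.
have form e f : e \in F -> f \in F -> e != f -> R e f -> edge_word e f = P.
  move=> eF fF ef; rewrite /R es eP; apply: edge_word_merge => //;
    [exact: (subsetP FH)|exact: (subsetP FH)|exact: partsP|exact: Fsep].
move=> hs; have us : uniq s.
  by apply: sorted_uniq_in hs; [apply: sub_in3 Rtr|apply: sub_in1 Rirr] => x; apply/(allP sF).
move: hs; rewrite (sorted_pairwise_in Rtr sF) => pw.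
have -> : size s = #|[set e in s]| by rewrite cardsE; apply/esym/card_uniqP.
apply: H_cliques; first exact: patterns_of_collectable Pl.
  by apply/subsetP => e; rewrite inE => /(allP sF) /(subsetP FH).
apply/forall_inP => e; rewrite inE => es1; apply/forall_inP => f; rewrite inE => fs1.
apply/implyP => ef; rewrite /forms_pattern.
have /andP[-> _] : is_pattern P && is_block_partition P (reshape [seq n.*2 | n <- l] P).
  by rewrite inE in Pl.
have eF := allP sF _ es1; have fF := allP sF _ fs1.
case/(nthP set0): es1 => i si ei; case/(nthP set0): fs1 => j sj ej.
have /(pairwiseP set0) hp := pw.
case: (ltngtP i j) => ij; last by move: ef; rewrite -ei -ej ij eqxx.
  by rewrite (form e f) ?eqxx // -ei -ej; apply: hp.
by rewrite (form f e) ?eqxx ?orbT // 1?eq_sym // -ei -ej; apply: hp.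
Qed.

(** Take a common antichain for the orders attached to the patterns of [l]. Two distinct edges with
    all parts comparable would be related in one of these orders, so some part overlaps. *)
Lemma large_pierced_subfamily (x0 : T) (l : ordpart r) (F : {set {set T}}) :
  F \subset H -> separated_family l F ->
  exists F' : {set {set T}}, [/\ F' \subset F,
    #|F| <= (\prod_(P in patterns_of l) m P) * #|F'| &
    {in F' &, forall e f, e != f -> exists2 c, new_cut l c &
        pierced c (nth x0 (vertices e) (part_start l c)) (vertices f)
     || pierced c (nth x0 (vertices f) (part_start l c)) (vertices e)}].
Proof.
move=> FH Fsep; have /andP[n0 /eqP sl] := partsP l.
have [|F' [sF' aF' cF']] := @large_common_antichain _ _ (enum (patterns_of l))
   (fun P e f => parts_ordered l (signs l P) (vertices e) (vertices f)) m F.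
  move=> P; rewrite mem_enum => Pl s; exact: chain_is_clique.
exists F'; split=> //; first by rewrite -big_enum.
move=> e f eF' fF' ef.
have eF := subsetP sF' _ eF'; have fF := subsetP sF' _ fF'.
have eH := subsetP FH _ eF; have fH := subsetP FH _ fF.
have [||[s ss hs]|[c hc pc]] := ordered_or_pierced x0 n0 _ _ (sorted_vertices e)
    (sorted_vertices f) (Fsep _ _ eF fF) (vertices_disjoint eH fH ef).
- by rewrite size_vertices.
- by rewrite size_vertices.
- exfalso.
  have [hd|hd] := boolP (head false s).
    have [P Pl eP] := block_word_pattern ss hd.
    by apply: (negP (aF' P _ e f eF' fF')); rewrite ?mem_enum ?eP.
  (* Exchanging [e] and [f] flips all signs, so the first one becomes A. *)
  have hd' : head false (map negb s).
    case: s ss hd {hs} => //= /esym/size0nil el; move: r_gt0; by rewrite -sl el.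
  have [|P Pl eP] := @block_word_pattern l _ _ hd'; first by rewrite size_map.
  by apply: (negP (aF' P _ f e fF' eF')); rewrite ?mem_enum ?eP ?parts_orderedC.
by exists c => //; rewrite orbC.
Qed.

(** * Iteration along refinement chains *)

Definition cut_succ (l l' : ordpart r) : bool :=
  ordpart_succ l l' && (size l' == (size l).+1).

(** The sum, over chains of [k] single cuts starting at [l], of the product of the weights [W],
    written recursively to match the induction on families. *)
Fixpoint chain_sum (W : ordpart r -> nat) (k : nat) (l : ordpart r) : nat :=
  W l * (if k is k'.+1 then \sum_(l' | cut_succ l l') chain_sum W k' l' else 1).

(** The default value [l] is never reached at a new cut. *)
Definition cut (l : ordpart r) (c : nat) : ordpart r := insubd l (cut_at c l).

Lemma val_cut (l : ordpart r) c : new_cut l c -> cut l c = cut_at c l :> seq nat.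
Proof. by move=> hc; rewrite insubdK //; apply: is_ordpart_cut_at (partsP l) hc. Qed.

Lemma cut_succ_cut (l : ordpart r) c : new_cut l c -> cut_succ l (cut l c).
Proof.
move=> hc; rewrite /cut_succ val_cut // size_cut_at // eqxx andbT.
apply/splits_toP; split; last by rewrite val_cut //; apply: cut_at_refines.
apply/eqP => e; have := size_cut_at hc; rewrite -val_cut // -e.
by move/eqP; rewrite eqn_leq ltnn andbF.
Qed.

Lemma new_cut_lt (l : ordpart r) c : new_cut l c -> c < r.
Proof. by have /andP[_ /eqP {2}<-] := partsP l; case/and3P. Qed.

(** Induction on the number [k] of cuts still missing: passing to an antichain costs the weight of
    [l], and choosing a piercing edge costs a factor 2. *)
Lemma family_bound k (l : ordpart r) (F : {set {set T}}) :
  size l + k = r -> F \subset H -> separated_family l F ->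
  #|F| <= 2 ^ k * chain_sum (fun l => \prod_(P in patterns_of l) m P) k l.
Proof.
set W := (X in chain_sum X).
have [-> _ _|[e0 e0F]] := set_0Vmem F; first by rewrite cards0.
move=> slk FH.
have [x0 _] : exists x0, x0 \in e0.
  have := size_vertices (subsetP FH _ e0F).
  case ev: (vertices e0) => [|x w]; first by move=> e; move: r_gt0; rewrite -e.
  by exists x; rewrite -mem_vertices ev mem_head.
elim: k l F {e0 e0F} slk FH => [|k IH] l F slk FH Fsep /=.
all: have [F' [sF' cF' pF']] := large_pierced_subfamily x0 FH Fsep.
all: apply: leq_trans cF' _.
  rewrite muln1 mul1n -[X in _ <= X]muln1 leq_mul2l; apply/orP; right.
  (* For [k = 0] there are [r] parts and no room for a new cut, so at most one edge survives. *)
  rewrite leqNgt; apply/negP => /card_gt1P[e [f [eF fF ef]]].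
  have [c] := pF' e f eF fF ef.
  by rewrite (all1_ordpart (partsP l)) //; lia.
rewrite mulnCA leq_mul2l; apply/orP; right.
have [->|F'0] := eqVneq F' set0; first by rewrite cards0.
have [|e he] := @half_covered _ 'I_r (fun c => new_cut l c) (fun e f c =>
    pierced c (nth x0 (vertices e) (part_start l c)) (vertices f)) F' F'0.
  move=> e f eF fF; have [<-|ef] := eqVneq e f.
    (* Diagonal pair: the edge is pierced by its own vertex of index [c.-1]. *)
    have [|c hc pc] := exists_new_cut (partsP l); first by lia.
    exists (Ordinal (new_cut_lt hc)) => //=; rewrite orbb pc.
    apply: pierced_pred; first exact: sorted_vertices.
    rewrite size_vertices; last by apply/(subsetP FH)/(subsetP sF').
    by rewrite (ltnW (new_cut_lt hc)); case/andP: hc => ->.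
  by have [c hc pc] := pF' e f eF fF ef; exists (Ordinal (new_cut_lt hc)).
apply: leq_trans he _; rewrite expnS -mulnA leq_mul2l /=.
apply: (@leq_trans (\sum_(c < r | new_cut l c) 2 ^ k * chain_sum W k (cut l c))).
  apply: leq_sum => c hc; apply: IH.
  - by rewrite val_cut // size_cut_at // addSnnS.
  - apply: subset_trans FH; apply: subset_trans sF'.
    by apply/subsetP => f; rewrite inE => /andP[].
  (* One vertex of [e] pierces both [f] and [g] at [c], which gives the new cut; the older cuts are
     inherited from [F]. *)
  move=> f g; rewrite !inE => /andP[fF pf] /andP[gF pg].
  apply/allP => c'; rewrite val_cut // psums_cut_at // inE => /predU1P[->|].
    by rewrite !(pierced_sep_at pf pg, pierced_sep_at pg pf).
  exact: (allP (Fsep f g (subsetP sF' _ fF) (subsetP sF' _ gF)) c').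
rewrite -big_distrr leq_mul2l /=; apply/orP; right.
apply: (leq_sum_inj (chain_sum W k)) => [c c' hc hc' e'|c hc]; last exact: cut_succ_cut.
apply/val_inj; apply: (cut_at_inj (l := l)) => //=.
by rewrite -!val_cut // e'.
Qed.

Lemma chain_sumE W k l :
  chain_sum W k l = \sum_(t : k.-tuple (ordpart r) | path cut_succ l t) \prod_(x <- l :: t) W x.
Proof.
elim: k l => [|k IH] l /=.
  rewrite (big_pred1 [tuple]) => [|t]; first by rewrite big_seq1 muln1.
  by rewrite tuple0.
rewrite big_distrr /=; under eq_bigr => l' _ do rewrite IH big_distrr.
rewrite pair_big_dep /=.
rewrite (reindex (fun p : ordpart r * k.-tuple (ordpart r) => [tuple of p.1 :: p.2])) /=; last first.
  exists (fun t => (thead t, [tuple of behead t])) => [[x t] _|t _] /=.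
    by congr (_, _); apply: val_inj.
  by rewrite [RHS]tuple_eta.
by apply: eq_bigr => p _; rewrite !big_cons.
Qed.

(** The number of parts strictly increases along the chain. *)
Lemma path_cut_succ_uniq (l : ordpart r) t : path cut_succ l t -> uniq (l :: t).
Proof.
move=> h; apply: (map_uniq (f := fun l : ordpart r => size l)).
apply: (sorted_uniq ltn_trans ltnn); rewrite sorted_map.
by apply: sub_path h => x y /andP[_ /eqP /= ->].
Qed.

Lemma path_cut_succ_sorted (l : ordpart r) t : path cut_succ l t -> sorted (@ordpart_succ r) (l :: t).
Proof. by apply: sub_path => x y /andP[]. Qed.

(** Uniqueness of block partitions makes the sets [patterns_of l] disjoint for distinct [l], so the
    product over their union factors. *)
Lemma prod_patterns_of (L : seq (ordpart r)) : uniq L ->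
  \prod_(P in \bigcup_(l <- L) patterns_of l) m P = \prod_(l <- L) \prod_(P in patterns_of l) m P.
Proof.
elim: L => [_|l L IH /= /andP[lL uL]]; first by rewrite !big_nil big_set0.
rewrite !big_cons -IH // -bigU /=; first by apply: eq_bigl => P; rewrite !inE.
rewrite -setI_eq0; apply/eqP/setP => P; rewrite in_set0 in_setI bigcup_seq.
apply/negP => /andP[Pl /bigcupP[l' l'L Pl']].
by move: lL; rewrite (patterns_of_inj Pl Pl') l'L.
Qed.

End Families.

Theorem theorem1p2 (r : nat) (r_gt0 : 0 < r)
    (m : (r.*2).-tuple letter -> nat)
    (m_gt0 : forall P : (r.*2).-tuple letter, collectable P -> 0 < m P)
    (d : Order.disp_t) (T : finOrderType d) (H : {set {set T}})
    (H_matching : ordered_matching r H)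
    (H_cliques : forall P : (r.*2).-tuple letter, collectable P ->
       forall K : {set {set T}}, K \subset H -> is_clique P K -> #|K| <= m P) :
  #|H| <= 2 ^ (r - 1) *
    \sum_(L : r.-tuple (ordpart r) | sorted (@ordpart_succ r) L)
      \prod_(P in \bigcup_(l <- L) patterns_of l) m P.
Proof.
have l0P : is_ordpart r [:: r] by rewrite /is_ordpart /= inE addn0 eqxx andbT eq_sym -lt0n.
have eE e : e \in H -> drop r (vertices e) = [::].
  by move=> eH; rewrite drop_oversize // (size_vertices H_matching).
have := family_bound r_gt0 H_matching H_cliques (k := r - 1) (l := OrdPart l0P) (F := H).
move=> /(_ _ (subxx _)) bound; apply: leq_trans (bound _ _) _ => [|e f eH fH|].
- by rewrite /= subnKC.
(* The only entry of [psums [:: r]] is [r], past which no vertex remains, so [H] itself is a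
   separated family. *)
- by apply/allP => c; rewrite inE => /eqP ->; rewrite /sep_at !eE ?allrel0r.
rewrite leq_mul2l; apply/orP; right; rewrite chain_sumE.
move: (OrdPart l0P) => l0 {l0P bound eE}.
case: r r_gt0 m m_gt0 H_matching H_cliques l0 => [//|k] _ m' _ _ _ l0.
rewrite subn1 /=.
under eq_bigr => t /path_cut_succ_uniq /(prod_patterns_of m') <- do [].
(* Prepending the starting composition embeds the chains of single cuts into all refinement chains
   of length [r]. *)
apply: (leq_sum_inj (h := fun t : k.-tuple (ordpart k.+1) => [tuple of l0 :: t])
  (fun L : k.+1.-tuple (ordpart k.+1) => \prod_(P in \bigcup_(l <- L) patterns_of l) m' P)).
  by move=> t t' _ _ /(congr1 val) [] /val_inj.
exact: path_cut_succ_sorted.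
Qed.
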